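(* Let $c_2,c_3$ be integers with $3\leq c_2\leq c_3$, and let $e=1+c_2+c_3$. Then $$\lambda(P_{1,c_2,c_3})=\begin{cases}5&\text{if }e\leq10;\\ \left\lceil\frac{-1+\sqrt{8e+1}}{2}\right\rceil&\text{if }e\geq11\text{ and }\left\lceil\frac{-1+\sqrt{8e+1}}{2}\right\rceil\text{ is odd};\\ \left\lceil\sqrt{2e}\right\rceil&\text{otherwise.}\end{cases}$$
   Context: For a graph $G$ (simple graph with at most one loop at each vertex), the edge-distinguishing chromatic number $\lambda(G)$ is the minimum positive integer $k$ for which there is a vertex coloring $c:V(G)\to\{1,\dotsc,k\}$ such that the edge labels $\{c(u),c(v)\}$ (a one-element set for a loop) are distinct for distinct edges $uv$. The petal graph $P_{1,c_2,c_3}$ consists of a vertex $u_0$ with a loop at $u_0$, together with a cycle through $u_0$ of length $c_2$ and a cycle through $u_0$ of length $c_3$, these sharing only $u_0$; it has $1+c_2+c_3$ edges. *)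

(* Defs.v *)
From mathcomp Require Import all_boot all_order all_algebra.
From mathcomp Require Import reals.

Set Implicit Arguments.
Unset Strict Implicit.
Unset Printing Implicit Defensive.

Local Open Scope nat_scope.

(* A finite simple graph with at most one loop at each vertex; [adj u u] means
   that there is a loop at [u]. *)
Record lgraph := LGraph {
  vertex :> finType;
  adj : rel vertex;
  adj_sym : symmetric adj
}.

(* An edge is identified with the set of its endpoints; a loop at [u] is
   [set u; u] = [set u]. *)
Definition edges (G : lgraph) : {set {set G}} :=
  [set [set p.1; p.2] | p : G * G & adj p.1 p.2].

(* The colors 1, ..., k are represented by 0, ..., k-1.  The image of an edge
   under c is its label: c @: [set u; v] = [set c u; c v]. *)
Definition edge_label (G : lgraph) (k : nat) (c : {ffun G -> 'I_k})
    (E : {set G}) : {set 'I_k} := c @: E.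

Definition edge_distinguishing (G : lgraph) (k : nat) (c : {ffun G -> 'I_k}) :
  bool := dinjectiveb (edge_label c) (edges G).

Definition edc_admissible (G : lgraph) (k : nat) : bool :=
  (0 < k) && [exists c : {ffun G -> 'I_k}, edge_distinguishing c].

Lemma edc_admissible_ex (G : lgraph) : exists k, edc_admissible G k.
Proof.
exists #|G|.+1; apply/existsP.
exists [ffun x => widen_ord (leqnSn #|G|) (enum_rank x)].
apply/dinjectiveP => E F _ _; apply: imset_inj => x y.
by rewrite !ffunE => /(congr1 val) /= /val_inj /enum_rank_inj.
Qed.

Definition edge_distinguishing_chromatic_number (G : lgraph) : nat :=
  ex_minn (edc_admissible_ex G).

(* [None] is the central vertex u_0; the c2-1 (resp. c3-1) other vertices of the
   cycle of length c2 (resp. c3) form the [inl] (resp. [inr]) summand, numbered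
   in the order in which the cycle visits them from u_0 back to u_0. *)
Definition petal_vertex (c2 c3 : nat) : finType :=
  option ('I_c2.-1 + 'I_c3.-1)%type.

Definition path_end (n : nat) (i : 'I_n) : bool := (i == 0 :> nat) || (i.+1 == n).

Definition path_adj (n : nat) (i j : 'I_n) : bool :=
  (i.+1 == j :> nat) || (j.+1 == i :> nat).

Definition petal_adj (c2 c3 : nat) : rel (petal_vertex c2 c3) := fun x y =>
  match x, y with
  | None, None => true
  | None, Some (inl i) | Some (inl i), None => path_end i
  | None, Some (inr i) | Some (inr i), None => path_end i
  | Some (inl i), Some (inl j) => path_adj i j
  | Some (inr i), Some (inr j) => path_adj i j
  | Some (inl _), Some (inr _) | Some (inr _), Some (inl _) => false
  end.

Lemma petal_adj_sym (c2 c3 : nat) : symmetric (@petal_adj c2 c3).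
Proof. by move=> [[i|i]|] [[j|j]|] //=; rewrite /path_adj orbC. Qed.

(* P_{1,c2,c3}, meaningful for 3 <= c2 and 3 <= c3. *)
Definition petal_graph (c2 c3 : nat) : lgraph := LGraph (@petal_adj_sym c2 c3).

(* Main.v *)
(* A coloring maps the two long cycles of the petal graph to closed trails
   through the color x of the center in the complete graph with loops on k
   colors; the trails are edge disjoint and avoid the loop at x.

   Lower bound: each color has even degree (loops counting twice) in the union
   of the labels, and degree at most k + 1, hence at most k if k is even.
   Summing the degrees gives 2e <= k (k + [k odd]).  For k = 4 this leaves only
   e = 7 and e = 8, which are excluded by enumeration.

   Upper bound: for k >= 5 this condition is also sufficient, by induction from k
   to k + 2.  The edges between the old colors and the two new colors a, b split
   into 4-cycles (v, a, v', b), and together with the edge ab and the loops at a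
   and b they form closed trails through the center of nearly every length up to
   the increment of the bound; such a trail is appended to the longer of the two.
   The trails for k <= 6, and those for k = 7, 8 of which both are too short to be
   obtained in this way, are given explicitly. *)
Require Import Defs.
From mathcomp Require Import all_boot all_order all_algebra.
From mathcomp Require Import reals.
From mathcomp Require Import zify lra.
Import Order.TTheory GRing.Theory Num.Theory.
Local Open Scope nat_scope.

(** * Labels and walks as sequences of colors *)

(** An unordered pair is coded by its sorted pair, so that distinctness of labels can be decided by
    computation. *)
Definition label (a b : nat) : nat * nat := (minn a b, maxn a b).

(* [x] is the color of the center, [p] and [q] are the colors of the other
   vertices of the two long cycles in the order of the cycle. *)
Definition petal_labels (x : nat) (p q : seq nat) : seq (nat * nat) :=
  label x x :: pairmap label x (rcons p x) ++ pairmap label x (rcons q x).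

Definition petal_trails (k x : nat) (p q : seq nat) : bool :=
  all (ltn^~ k) (x :: p ++ q) && uniq (petal_labels x p q).

Lemma labelP (a b c d : nat) :
  reflect ((a = c /\ b = d) \/ (a = d /\ b = c)) (label a b == label c d).
Proof. rewrite /label xpair_eqE; apply: (iffP idP); lia. Qed.

Lemma eq_set2_label (T : finType) (f : T -> nat) (a b c d : T) :
  injective f ->
  ([set a; b] == [set c; d]) = (label (f a) (f b) == label (f c) (f d)).
Proof.
move=> f_inj; apply/eqP/labelP => [/setP E | [[/f_inj-> /f_inj->]|[/f_inj-> /f_inj->]]] //.
  have := E a; have := E b; have := E c; have := E d.
  rewrite !inE !eqxx ?orbT /= => Ed Ec Eb Ea.
  have /orP[/eqP?|/eqP?] : (a == c) || (a == d) by rewrite -Ea.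
    have /orP[/eqP?|/eqP?] : (d == a) || (d == b) by rewrite Ed.
      have /orP[/eqP?|/eqP?] : (b == c) || (b == d) by rewrite -Eb.
        by left; split; congruence.
      by left; split; congruence.
    by left; split; congruence.
  have /orP[/eqP?|/eqP?] : (c == a) || (c == b) by rewrite Ec.
    have /orP[/eqP?|/eqP?] : (b == c) || (b == d) by rewrite -Eb.
      by right; split; congruence.
    by right; split; congruence.
  by right; split; congruence.
by rewrite setUC.
Qed.

Lemma uniq_map_eq (T : Type) (U W : eqType) (f : T -> U) (g : T -> W) (s : seq T) :
  (forall x y, (f x == f y) = (g x == g y)) ->
  uniq [seq f x | x <- s] = uniq [seq g x | x <- s].
Proof.
move=> fg; elim: s => //= x s ->; congr (~~ _ && _).
by elim: s => //= y s IH; rewrite !inE fg IH.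
Qed.

Lemma map_pairmap (T U W : Type) (f : T -> T -> U) (g : U -> W) (x : T) (s : seq T) :
  [seq g y | y <- pairmap f x s] = pairmap (fun a b => g (f a b)) x s.
Proof. by elim: s x => //= y s IH x; rewrite IH. Qed.

Lemma pairmap_map (T T' U : Type) (h : T' -> T) (f : T -> T -> U) (x : T') (s : seq T') :
  pairmap f (h x) [seq h y | y <- s] = pairmap (fun a b => f (h a) (h b)) x s.
Proof. by elim: s x => //= y s IH x; rewrite IH. Qed.

Lemma pairmap_labels_iota (a n : nat) :
  pairmap label a (iota a.+1 n) = [seq (j, j.+1) | j <- iota a n].
Proof.
elim: n a => //= n IH a; rewrite IH; congr (_ :: _).
by rewrite /label; congr (_, _); lia.
Qed.

Lemma labels_cycle_iota (a n : nat) :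
  pairmap label 0 (rcons (iota a n.+1) 0) =
  (0, a) :: rcons [seq (j, j.+1) | j <- iota a n] (0, a + n).
Proof.
rewrite -cats1 pairmap_cat /= pairmap_labels_iota cats1.
congr (_ :: _); first by rewrite /label; congr (_, _); lia.
have -> : last a (iota a.+1 n) = a + n.
  by elim: n a => [|n IH] a /=; rewrite ?addn0 // IH addSnnS.
by rewrite /label minn0 maxn0.
Qed.

Lemma nth_cycle (T : Type) (n : nat) (f : 'I_n -> T) (x : T) (i : 'I_n) :
  nth x (rcons [seq f j | j <- enum 'I_n] x) i = f i.
Proof.
rewrite nth_rcons size_map size_enum_ord ltn_ord (nth_map i) ?size_enum_ord //.
by rewrite nth_ord_enum.
Qed.

Lemma mem_cycle (T : eqType) (n : nat) (f : 'I_n -> T) (x y z : T) :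
  0 < n ->
  reflect [\/ exists2 i : 'I_n, i = 0 :> nat & y = x /\ z = f i,
             exists2 i : 'I_n, i.+1 = n :> nat & y = f i /\ z = x |
             exists i j : 'I_n, [/\ i.+1 = j :> nat, y = f i & z = f j]]
    ((y, z) \in pairmap pair x (rcons [seq f i | i <- enum 'I_n] x)).
Proof.
move=> n_gt0; set s := rcons _ _.
have sz : size s = n.+1 by rewrite size_rcons size_map size_enum_ord.
have s_n : nth x s n = x.
  by rewrite nth_rcons size_map size_enum_ord ltnn eqxx.
apply: (iffP (nthP (x, x))) => [[k]|].
  rewrite size_pairmap sz ltnS => k_le; rewrite (nth_pairmap x) ?sz // => -[<- <-].
  case: k k_le => [|k] k_le /=.
    by constructor 1; exists (Ordinal n_gt0); rewrite // -[0]/(Ordinal n_gt0 : nat) nth_cycle.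
  have -> : nth x s k = f (Ordinal k_le) by rewrite -(nth_cycle _ _ f x).
  have [k_lt|n_le] := ltnP k.+1 n.
    constructor 3; exists (Ordinal k_le), (Ordinal k_lt); split=> //.
    by rewrite -[k.+1]/(Ordinal k_lt : nat) nth_cycle.
  have kn : k.+1 = n by apply/eqP; rewrite eqn_leq k_le.
  by constructor 2; exists (Ordinal k_le) => //; rewrite kn s_n.
have mem k : k <= n -> exists2 i, i < size (pairmap pair x s) &
    nth (x, x) (pairmap pair x s) i = (nth x (x :: s) k, nth x s k).
  by move=> k_le; exists k; rewrite ?size_pairmap ?sz // (nth_pairmap x) ?sz.
case=> [[i i0 [-> ->]]|[i i1 [-> ->]]|[i [j [ij -> ->]]]].
- by have := mem 0 isT; rewrite /= -i0 nth_cycle.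
- by have := mem n (leqnn n); rewrite s_n -[X in nth _ (x :: s) X]i1 /= nth_cycle.
- by have := mem j (ltnW (ltn_ord j)); rewrite nth_cycle -ij /= nth_cycle.
Qed.

(** * From the petal graph to pairs of closed trails *)

Section Petal.
Variables c2 c3 : nat.
Hypotheses (hc2 : 3 <= c2) (hc3 : 3 <= c3).
Notation G := (petal_graph c2 c3).

Definition left_cycle : seq G := [seq Some (inl i) | i <- enum 'I_c2.-1].
Definition right_cycle : seq G := [seq Some (inr i) | i <- enum 'I_c3.-1].

Definition petal_edges : seq (G * G) :=
  (None, None) :: pairmap pair (None : G) (rcons left_cycle (None : G))
    ++ pairmap pair (None : G) (rcons right_cycle (None : G)).

Lemma map_petal_edges (f : G -> nat) :
  [seq label (f x.1) (f x.2) | x <- petal_edges] =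
  petal_labels (f None) [seq f (Some (inl i)) | i <- enum 'I_c2.-1]
    [seq f (Some (inr i)) | i <- enum 'I_c3.-1].
Proof.
rewrite /petal_edges /petal_labels /= map_cat !map_pairmap /=.
by rewrite -!(pairmap_map _ _ _ f label) !map_rcons /left_cycle /right_cycle -!map_comp.
Qed.

Lemma uniq_petal_edges : uniq [seq [set x.1; x.2] | x <- petal_edges].
Proof.
(* The center is numbered 0, the first cycle from 1, the second from [c2]. Each cycle becomes a run
   of consecutive numbers closed by two edges at 0, distinct since its length is at least 3. *)
pose code (x : G) : nat := match x with
  | None => 0 | Some (inl i) => i.+1 | Some (inr i) => c2 + i end.
have code_inj : injective code.
  case=> [[i|i]|] [[j|j]|] //=.
  - by move=> [/val_inj->].
  - by have := ltn_ord i; lia.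
  - by have := ltn_ord j; lia.
  - by move/addnI/val_inj->.
  - lia.
  - lia.
rewrite (uniq_map_eq _ _ _ _ (fun x => label (code x.1) (code x.2))); last first.
  by move=> x y; apply: eq_set2_label.
rewrite map_petal_edges /petal_labels /=.
have -> : [seq (nat_of_ord i).+1 | i <- enum 'I_c2.-1] = iota 1 c2.-1.
  by rewrite (map_comp S val) val_enum_ord -[1]/(1 + 0) iotaDl.
have -> : [seq c2 + nat_of_ord i | i <- enum 'I_c3.-1] = iota c2 c3.-1.
  by rewrite (map_comp (addn c2) val) val_enum_ord -[in RHS](addn0 c2) iotaDl.
have -> : c2.-1 = c2.-2.+1 by lia.
have -> : c3.-1 = c3.-2.+1 by lia.
have E0 a b n : 0 < a -> (0, b) \in [seq (j, j.+1) | j <- iota a n] = false.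
  by move=> a0; apply/mapP => -[j]; rewrite mem_iota => ? [? ?]; lia.
have E1 b : has (in_mem^~ (mem ([seq (j, j.+1) | j <- iota 1 c2.-2] ++ [:: (0, b)])))
    [seq (j, j.+1) | j <- iota c2 c3.-2] = false.
  apply/hasP => -[_ /mapP[j + ->]] /=; rewrite mem_cat inE mem_iota => ?.
  by case/orP => [/mapP[i + [ij _]]|/eqP[]]; rewrite ?mem_iota; lia.
have Su a n : uniq [seq (j, j.+1) | j <- iota a n].
  by rewrite map_inj_uniq ?iota_uniq // => i j [].
rewrite !labels_cycle_iota -!cats1 /= !(cat_uniq, has_cat, E1, Su) /=.
rewrite !(cat_uniq, has_cat, mem_cat, inE, E0, Su, xpair_eqE) //=; try lia.
rewrite E1 !(mem_cat, inE, E0, xpair_eqE) //=; try lia.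
Qed.

Lemma mem_petal_edges (y z : G) :
  ((y, z) \in petal_edges) =
  [|| (y == None) && (z == None),
      (y, z) \in pairmap pair (None : G) (rcons left_cycle None) |
      (y, z) \in pairmap pair (None : G) (rcons right_cycle None)].
Proof. by rewrite inE mem_cat xpair_eqE. Qed.

Lemma edges_petal_graph : edges G =i [seq [set x.1; x.2] | x <- petal_edges].
Proof.
have n2 : 0 < c2.-1 by lia.
have n3 : 0 < c3.-1 by lia.
move=> E; apply/imsetP/mapP => -[[y z]].
  rewrite inE /= => yz ->.
  (* The list holds each edge in one orientation only, the one in which the cycle traverses it. *)
  suff : ((y, z) \in petal_edges) || ((z, y) \in petal_edges).
    by case/orP=> ?; [exists (y, z) | exists (z, y); rewrite //= setUC].
  rewrite !mem_petal_edges.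
  have in2 u v H : _ := introT (mem_cycle _ _ (fun i => Some (inl i) : G) None u v n2) H.
  have in3 u v H : _ := introT (mem_cycle _ _ (fun i => Some (inr i) : G) None u v n3) H.
  case: y z yz => [[i|i]|] [[j|j]|] //= /orP[]/eqP ij.
  - by rewrite (in2 (Some (inl i)) (Some (inl j))) //; constructor 3; exists i, j.
  - by rewrite (in2 (Some (inl j)) (Some (inl i))) ?orbT //; constructor 3; exists j, i.
  - by rewrite (in2 None (Some (inl i))) ?orbT //; constructor 1; exists i.
  - by rewrite (in2 (Some (inl i)) None) //; constructor 2; exists i.
  - by rewrite (in3 (Some (inr i)) (Some (inr j))) ?orbT //; constructor 3; exists i, j.
  - by rewrite (in3 (Some (inr j)) (Some (inr i))) ?orbT //; constructor 3; exists j, i.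
  - by rewrite (in3 None (Some (inr i))) ?orbT //; constructor 1; exists i.
  - by rewrite (in3 (Some (inr i)) None) ?orbT //; constructor 2; exists i.
  - by rewrite (in2 None (Some (inl j))) ?orbT //; constructor 1; exists j.
  - by rewrite (in2 (Some (inl j)) None) ?orbT //; constructor 2; exists j.
  - by rewrite (in3 None (Some (inr j))) ?orbT //; constructor 1; exists j.
  - by rewrite (in3 (Some (inr j)) None) ?orbT //; constructor 2; exists j.
rewrite mem_petal_edges => yz ->; exists (y, z) => //; rewrite inE /=.
case/or3P: yz => [/andP[/eqP-> /eqP->] //|/(mem_cycle _ _ _ _ _ _ n2)|/(mem_cycle _ _ _ _ _ _ n3)].
  by case=> [[i i0 [-> ->]]|[i i1 [-> ->]]|[i [j [ij -> ->]]]] /=;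
    rewrite /path_end /path_adj ?i0 ?i1 ?ij eqxx ?orbT.
by case=> [[i i0 [-> ->]]|[i i1 [-> ->]]|[i [j [ij -> ->]]]] /=;
  rewrite /path_end /path_adj ?i0 ?i1 ?ij eqxx ?orbT.
Qed.

(** [petal_edges] enumerates the edge set without repetition, so injectivity on the set becomes
    [uniq] on the list of labels. *)
Lemma edge_distinguishing_petal_labels (k : nat) (c : {ffun G -> 'I_k}) :
  edge_distinguishing c =
  uniq (petal_labels (c None) [seq nat_of_ord (c (Some (inl i))) | i <- enum 'I_c2.-1]
    [seq nat_of_ord (c (Some (inr i))) | i <- enum 'I_c3.-1]).
Proof.
rewrite -(map_petal_edges (fun x => nat_of_ord (c x))).
have E : perm_eq (enum (edges G)) [seq [set x.1; x.2] | x <- petal_edges].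
  apply: uniq_perm; rewrite ?enum_uniq ?uniq_petal_edges // => e.
  by rewrite mem_enum edges_petal_graph.
rewrite /edge_distinguishing /dinjectiveb (perm_uniq (perm_map _ E)) -map_comp.
apply: uniq_map_eq => x y /=.
by rewrite /edge_label !imsetU1 !imset_set1; apply: eq_set2_label; apply: val_inj.
Qed.

(** Removes the graph from the problem: what remains is to find two sequences of colors. *)
Lemma edc_admissible_petalP (k : nat) :
  reflect (exists x p q, [/\ size p = c2.-1, size q = c3.-1 & petal_trails k x p q])
    (edc_admissible G k).
Proof.
apply: (iffP andP) => [[k_gt0 /existsP[c]]|[x [p [q [sp sq]]]]].
  rewrite edge_distinguishing_petal_labels => c_uniq; do 3!eexists.
  split; last first.
  - apply/andP; split; last exact: c_uniq.
    rewrite /= ltn_ord all_cat /=; apply/andP; split; apply/allP => _ /mapP[i _ ->]; exact: ltn_ord.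
  - by rewrite size_map size_enum_ord.
  - by rewrite size_map size_enum_ord.
case/andP=> /= /andP[x_lt]; rewrite all_cat => /andP[p_lt q_lt] pq_uniq.
split; first exact: leq_ltn_trans x_lt.
apply/existsP.
pose c (v : G) : nat := match v with
  | None => x | Some (inl i) => nth 0 p i | Some (inr i) => nth 0 q i end.
have c_lt v : c v < k.
  by case: v => [[i|i]|] //=; [apply: (all_nthP 0 p_lt)|apply: (all_nthP 0 q_lt)];
    rewrite ?sp ?sq ltn_ord.
exists [ffun v => Ordinal (c_lt v)].
rewrite edge_distinguishing_petal_labels ffunE.
have -> : [seq nat_of_ord ([ffun v => Ordinal (c_lt v)] (Some (inl i) : G)) |
    i <- enum 'I_c2.-1] = p.
  apply: (@eq_from_nth _ 0); rewrite size_map size_enum_ord // => i i_lt.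
  by rewrite (nth_map (Ordinal i_lt)) ?size_enum_ord // ffunE /= nth_enum_ord.
have -> : [seq nat_of_ord ([ffun v => Ordinal (c_lt v)] (Some (inr i) : G)) |
    i <- enum 'I_c3.-1] = q.
  apply: (@eq_from_nth _ 0); rewrite size_map size_enum_ord // => i i_lt.
  by rewrite (nth_map (Ordinal i_lt)) ?size_enum_ord // ffunE /= nth_enum_ord.
by [].
Qed.

End Petal.

(** * The degree bound *)

Definition degree (v : nat) (s : seq (nat * nat)) : nat :=
  \sum_(e <- s) ((e.1 == v) + (e.2 == v)).

(** Each inner visit to [v] is entered and left, so only the two ends affect the parity. *)
Lemma odd_degree_walk (v x : nat) (s : seq nat) :
  odd (degree v (pairmap label x s)) = (x == v) (+) (last x s == v).
Proof.
rewrite /degree; elim: s x => [|y s IH] x /=; first by rewrite big_nil addbb.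
rewrite big_cons /= oddD IH /label oddD !oddb /minn /maxn.
by case: ifP; case: (x == v); case: (y == v); case: (last y s == v).
Qed.

Lemma odd_degree_petal (v x : nat) (p q : seq nat) :
  odd (degree v (petal_labels x p q)) = false.
Proof.
have -> : petal_labels x p q =
    (x, x) :: pairmap label x (rcons p x) ++ pairmap label x (rcons q x).
  by rewrite /petal_labels /label minnn maxnn.
by rewrite /degree big_cons big_cat !oddD !odd_degree_walk !last_rcons !addbb.
Qed.

(** An edge at [v] is determined by its other end, which leaves at most [k] edges; the loop counts
    once more. *)
Lemma degree_le (k v : nat) (s : seq (nat * nat)) :
  uniq s -> {in s, forall e, e.1 <= e.2 < k} -> degree v s <= k.+1.
Proof.
move=> s_uniq s_lt.
pose inc (e : nat * nat) := (e.1 == v) || (e.2 == v).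
pose other (e : nat * nat) := if e.1 == v then e.2 else e.1.
have -> : degree v s = count inc s + count_mem (v, v) s.
  rewrite /degree; elim: (s) => [|[a b] t IH]; first by rewrite big_nil.
  by rewrite big_cons IH /= /inc xpair_eqE; case: (_ == v); case: (_ == v) => /=; lia.
rewrite -addn1 leq_add //; last by rewrite count_uniq_mem // leq_b1.
rewrite -size_filter -(size_map other) -[leqRHS](size_iota 0 k).
apply: uniq_leq_size.
  rewrite map_inj_in_uniq ?filter_uniq // => -[a b] [c d].
  rewrite !mem_filter /inc /other /= => /andP[+ /s_lt/=] => + + /andP[+ /s_lt/=].
  by case: (eqVneq a v) (eqVneq b v) (eqVneq c v) (eqVneq d v) => [?|?] [?|?] [?|?] [?|?] //= *;
    congr (_, _); lia.
move=> _ /mapP[[a b] + ->]; rewrite mem_filter mem_iota /other => /andP[_ /s_lt /=].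
by case: ifP => _; lia.
Qed.

Lemma sum_degree (k : nat) (s : seq (nat * nat)) :
  {in s, forall e, e.1 <= e.2 < k} -> \sum_(v < k) degree v s = 2 * size s.
Proof.
move=> s_lt.
have one a : a < k -> \sum_(v < k) (a == v) = 1.
  move=> a_lt; rewrite (bigD1 (Ordinal a_lt)) //= eqxx big1 // => i.
  by rewrite -val_eqE /= eq_sym => /negbTE->.
rewrite exchange_big /= (eq_big_seq (fun=> 2)); last first.
  by move=> e /s_lt ?; rewrite big_split /= !one //; lia.
by rewrite big_const_seq count_predT iter_addn_0.
Qed.

Lemma petal_labels_lt (k x : nat) (p q : seq nat) :
  all (ltn^~ k) (x :: p ++ q) ->
  {in petal_labels x p q, forall e, e.1 <= e.2 < k}.
Proof.
have lab a b : a < k -> b < k -> (label a b).1 <= (label a b).2 < k.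
  by rewrite /label /=; lia.
have walk y s : all (ltn^~ k) (y :: s) ->
    {in pairmap label y s, forall e, e.1 <= e.2 < k}.
  elim: s y => //= z s IH y /and3P[y_lt z_lt s_lt] e.
  rewrite inE => /orP[/eqP->|]; first exact: lab.
  by apply: IH; rewrite /= z_lt.
rewrite /= all_cat => /and3P[x_lt p_lt q_lt] e.
rewrite inE mem_cat => /or3P[/eqP->|/walk->|/walk->//]; rewrite ?lab //= ?all_rcons ?x_lt //=.
Qed.

Lemma size_petal_labels (x : nat) (p q : seq nat) :
  size (petal_labels x p q) = (size p + size q).+3.
Proof. by rewrite /= size_cat !size_pairmap !size_rcons addnS. Qed.

Lemma petal_trails_bound (k x : nat) (p q : seq nat) :
  petal_trails k x p q -> 2 * (size p + size q).+3 <= k * (k + odd k).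
Proof.
case/andP=> /petal_labels_lt lt_k uniq_pq.
rewrite -(size_petal_labels x) -(sum_degree k) //.
have -> : k * (k + odd k) = \sum_(v < k) (k + odd k) by rewrite sum_nat_const card_ord.
apply: leq_sum => v _.
have := degree_le k v _ uniq_pq lt_k; have := odd_degree_petal v x p q.
(* The degree is even, so for even [k] the bound k + 1 improves to k. *)
by case: (boolP (odd k)); lia.
Qed.

(** * Extension from k to k + 2 colors *)

(** For existence the color of the center may be chosen; the new trails start and end at 0. *)
Definition trail_pair (k c2 c3 : nat) : Prop :=
  exists p q, [/\ size p = c2.-1, size q = c3.-1 & petal_trails k 0 p q].

Lemma trail_pair_sym (k c2 c3 : nat) : trail_pair k c2 c3 -> trail_pair k c3 c2.
Proof.
case=> p [q [sp sq /andP[lt_k pq_uniq]]]; exists q, p; split=> //.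
apply/andP; split; first by move: lt_k; rewrite /= !all_cat => /and3P[-> -> ->].
by move: pq_uniq; rewrite /= mem_cat orbC -mem_cat uniq_catC.
Qed.

Lemma trail_pair_widen (k k' c2 c3 : nat) :
  k <= k' -> trail_pair k c2 c3 -> trail_pair k' c2 c3.
Proof.
move=> kk' [p [q [sp sq /andP[lt_k pq_uniq]]]]; exists p, q; split=> //.
apply/andP; split=> //; apply: sub_all lt_k => i /leq_trans; exact.
Qed.

(* To be inserted after a visit of [a]: the 4-cycles [a, 2i+1, b, 2i+2] for
   [i < t], each returning to [a]. *)
Fixpoint detours (a b t : nat) : seq nat :=
  if t is i.+1 then [:: i.*2.+1; b; i.*2.+2; a] ++ detours a b i else [::].

(* The inner vertices of a closed trail at 0 all of whose edges meet the new
   colors [k] and [k.+1]; the loops at these are used according to [la], [lb].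
   The edge [k, k.+1] is avoided if [k] is even, and replaced by a path through
   the last old color. *)
Definition new_trail (k t : nat) (la lb : bool) : seq nat :=
  k :: detours k k.+1 t ++ nseq la k ++ nseq (~~ odd k) k.-1 ++ k.+1 :: nseq lb k.+1.

Lemma size_new_trail (k t : nat) (la lb : bool) :
  size (new_trail k t la lb) = ~~ odd k + 4 * t + la + lb + 2.
Proof.
have sz : size (detours k k.+1 t) = 4 * t by elim: t => //= t ->; lia.
by rewrite /= !size_cat /= !size_nseq sz; lia.
Qed.

Lemma new_trail_lt (k t : nat) (la lb : bool) :
  0 < k -> 2 * t < k -> all (ltn^~ k.+2) (new_trail k t la lb).
Proof.
move=> k_gt0 t_lt; rewrite /= !all_cat /= !all_nseq /=.
have -> : all (ltn^~ k.+2) (detours k k.+1 t).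
  by elim: t t_lt => //= t IH t_lt; rewrite IH; lia.
lia.
Qed.

(** The detours use the old colors 1 to 2t. The hypothesis keeps these below k, and for even k below
    k - 1, the color that links the two new ones. As each label contains a new color, no trail on
    old colors uses it. *)
Lemma new_trail_labels (k t : nat) (la lb : bool) :
  2 * t + 1 + ~~ odd k <= k ->
  uniq (pairmap label 0 (rcons (new_trail k t la lb) 0)) /\
  all (fun e => k <= e.2) (pairmap label 0 (rcons (new_trail k t la lb) 0)).
Proof.
move=> t_le; rewrite /new_trail rcons_cons rcons_cat.
set s := rcons (_ ++ _) 0.
(* After [i] detours the old colors between 2i + 1 and 2t are still untouched, so the next detour
   adds only fresh labels. *)
pose inv i (e : nat * nat) := (k <= e.2) && ((e.1 <= 2 * i) || (2 * t < e.1)).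
suff /(_ t (leqnn t)) [u_t /allP inv_t] : forall i, i <= t ->
    uniq ((0, k) :: pairmap label k (detours k k.+1 i ++ s)) /\
    all (inv i) (pairmap label k (detours k k.+1 i ++ s)).
  have -> : pairmap label 0 (k :: detours k k.+1 t ++ s) =
      (0, k) :: pairmap label k (detours k k.+1 t ++ s).
    by rewrite /= /label min0n max0n.
  by split=> //=; rewrite leqnn; apply/allP => e /inv_t /andP[].
have lab_lt a b : a < b -> label a b = (a, b) /\ label b a = (a, b).
  by rewrite /label => ?; split; congr (_, _); lia.
have lab_eq a : label a a = (a, a) by rewrite /label minnn maxnn.
elim=> [_|i IH i_lt].
  rewrite /s; clear s; have k_gt0 : 0 < k by lia.
  have [l1 l1'] := lab_lt k.-1 k ltac:(lia).
  have [l2 l2'] := lab_lt k.-1 k.+1 ltac:(lia).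
  have [l3 l3'] := lab_lt k k.+1 ltac:(lia).
  have [l4 l4'] := lab_lt 0 k.+1 ltac:(lia).
  by case: la lb (boolP (odd k)) t_le => -[] [] odd_k t_le;
    rewrite /= ?lab_eq ?l1' ?l2 ?l3 ?l4' /inv /= !inE !xpair_eqE; lia.
have [u_i inv_i] := IH (ltnW i_lt).
have [l1 l1'] := lab_lt i.*2.+1 k ltac:(lia).
have [l2 l2'] := lab_lt i.*2.+1 k.+1 ltac:(lia).
have [l3 l3'] := lab_lt i.*2.+2 k.+1 ltac:(lia).
have [l4 l4'] := lab_lt i.*2.+2 k ltac:(lia).
rewrite /= l1' l2 l3' l4.
have notin_i a b : 2 * i < a <= 2 * t -> (a, b) \notin pairmap label k (detours k k.+1 i ++ s).
  by move=> ab; apply/negP => /(allP inv_i); rewrite /inv /=; lia.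
split.
  move: u_i; rewrite /= => /andP[k_notin ->].
  by rewrite !inE !xpair_eqE (negPf k_notin) !(negPf (notin_i _ _ _)); lia.
rewrite /inv /=; apply/and5P; split; try lia.
by apply: sub_all inv_i => e /andP[-> /=]; lia.
Qed.

(** The second trail, once back at 0, continues along the new one. The length grows by the size of
    the new trail plus one, for the edge that returns to 0. *)
Lemma trail_pair_extend (k t c2 c3 : nat) (la lb : bool) :
  0 < c3 -> 2 * t + 1 + ~~ odd k <= k -> trail_pair k c2 c3 ->
  trail_pair k.+2 c2 (c3 + (3 + ~~ odd k + 4 * t + la + lb)).
Proof.
move=> c3_gt0 t_le [p [q [sp sq /andP[lt_k pq_uniq]]]].
exists p, (q ++ 0 :: new_trail k t la lb); split=> //.
  by rewrite size_cat /= -/(size _) -[(size _).+1]/(size (new_trail k t la lb)) size_new_trail; lia.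
have [n_uniq /allP n_ge] := new_trail_labels k t la lb t_le.
apply/andP; split.
  rewrite catA -cat_cons all_cat; apply/andP; split; last by apply: new_trail_lt; lia.
  by apply: sub_all lt_k => i /=; lia.
have -> : petal_labels 0 p (q ++ 0 :: new_trail k t la lb) =
    petal_labels 0 p q ++ pairmap label 0 (rcons (new_trail k t la lb) 0).
  by rewrite /petal_labels -cat_rcons rcons_cat pairmap_cat last_rcons catA.
rewrite cat_uniq pq_uniq n_uniq andbT andTb; apply/hasPn => e /n_ge e_ge.
by apply/negP => /(petal_labels_lt _ _ _ _ lt_k); lia.
Qed.

Lemma extension_length (k d : nat) :
  4 < k -> d <= 2 * k + 2 + odd k ->
  exists t (la lb : bool), 2 * t + 1 + ~~ odd k <= k /\
    d <= 3 + ~~ odd k + 4 * t + la + lb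
      <= maxn 4 (minn d.+1 (2 * k + 2 + odd k)).
Proof.
move=> k_gt4 d_le.
(* [h] is the largest number of detours allowed; [z] records that [k] is even. *)
have [h [z [kE zE]]] : exists h (z : bool), k = h.*2.+1 + z /\ odd k = ~~ z.
  by exists (k.-1)./2, (~~ odd k); split; lia.
rewrite zE negbK in d_le *.
have [d_small|d_big] := leqP d (3 + z).
  by exists 0, false, false; lia.
have dE := divn_eq (d - (3 + z)) 4.
have := ltn_pmod (d - (3 + z)) (isT : 0 < 4).
set t := _ %/ 4 in dE; set r := _ %% 4 in dE *; move=> r_lt.
have [r0|[r1|[r2|r3]]] : r = 0 \/ r = 1 \/ r = 2 \/ r = 3 by lia.
- by exists t, false, false; lia.
- by exists t, true, false; lia.
- by exists t, true, true; lia.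
(* Here [t] < [h], because the maximal length exceeds 3 + z by 4h + 2. *)
- by exists t.+1, false, false; lia.
Qed.

(** * The induction and its explicit cases *)

Definition trail_pairs_exist (k : nat) : Prop :=
  forall c2 c3, 3 <= c2 <= c3 -> 2 * (1 + c2 + c3) <= k * (k + odd k) ->
  trail_pair k c2 c3.

(* Either the reduction to [k] colors works, or the second cycle is too short
   for it. *)
Lemma trail_pairs_step (k c2 c3 : nat) :
  4 < k -> trail_pairs_exist k -> 3 <= c2 <= c3 ->
  2 * (1 + c2 + c3) <= k.+2 * (k.+2 + odd k) ->
  trail_pair k.+2 c2 c3 \/
  exists d, [/\ 2 * (1 + c2 + c3) = k * (k + odd k) + 2 * d,
    0 < d & c3 < 3 + maxn 4 (minn d.+1 (2 * k + 2 + odd k))].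
Proof.
move=> k_gt4 exist_k c23 e_le.
have [e_le_k|e_gt_k] := leqP (2 * (1 + c2 + c3)) (k * (k + odd k)).
  by left; apply: (trail_pair_widen k); [lia | apply: exist_k].
have [M ME] : exists M, k * (k + odd k) = 2 * M.
  exists (k * (k + odd k))./2.
  have : odd (k * (k + odd k)) = false by rewrite oddM oddD oddb addbb andbF.
  by lia.
have capE : k.+2 * (k.+2 + odd k) = k * (k + odd k) + 2 * (2 * k + 2 + odd k) by nia.
(* The excess over what [k] colors can carry; the new trail must absorb at least this many edges. *)
pose d := 1 + c2 + c3 - M.
have [t [la [lb [t_le /andP[d_le r_le]]]]] := extension_length k d k_gt4 ltac:(lia).
set r := _ + lb in d_le r_le.
(* What remains of the second cycle must still have length at least 3. *)
have [c3_big|c3_small] := leqP (3 + r) c3; last by right; exists d; split; lia.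
left; have -> : c3 = (c3 - r) + r by lia.
apply: trail_pair_extend => //; first by lia.
(* Shortening may reverse the order of the two lengths. *)
have [c2_le|c2_gt] := leqP c2 (c3 - r); first by apply: exist_k; lia.
by apply: trail_pair_sym; apply: exist_k; lia.
Qed.

(* Lets one table entry cover several pairs of lengths.  The default [x.+1] of
   [head] differs from [x]. *)
Fixpoint drop_loops (d : nat) (s : seq nat) : seq nat :=
  if s is x :: t then
    if (0 < d) && (x == head x.+1 t) then drop_loops d.-1 t else x :: drop_loops d t
  else [::].

(** Sizes and labels are rechecked after loops are dropped, so nothing about the tables has to be
    trusted. *)
Definition table_covers (k : nat) (T : seq (seq nat * seq nat)) (c2 c3 : nat) : bool :=
  has (fun pq => let p := drop_loops (size pq.1 - c2.-1) pq.1 in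
                 let q := drop_loops (size pq.2 - c3.-1) pq.2 in
                 [&& size p == c2.-1, size q == c3.-1 & petal_trails k 0 p q]) T.

Lemma table_covers_trail_pair (k : nat) (T : seq (seq nat * seq nat)) (c2 c3 : nat) :
  table_covers k T c2 c3 -> trail_pair k c2 c3.
Proof. by case/hasP=> -[p q] _ /= /and3P[/eqP sp /eqP sq pq]; do 2!eexists; split; eauto. Qed.

Definition table5 : seq (seq nat * seq nat) := [::
  ([:: 1; 1; 4; 4; 3; 3], [:: 2; 2; 1; 3; 2; 4]);
  ([:: 4; 4; 3; 3; 2], [:: 1; 1; 2; 2; 4; 1; 3]);
  ([:: 4; 4; 1; 1], [:: 3; 3; 1; 2; 2; 3; 4; 2]);
  ([:: 4; 4; 2], [:: 1; 1; 2; 2; 3; 3; 4; 1; 3]);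
  ([:: 1; 4], [:: 2; 2; 3; 3; 4; 4; 2; 1; 1; 3]);
  ([:: 1; 1; 2; 2], [:: 3; 3; 4; 4]);
  ([:: 3; 2], [:: 4; 4; 3; 3; 1])].

Definition table6 : seq (seq nat * seq nat) := [::
  ([:: 5; 5; 1; 1; 4; 4; 2], [:: 1; 3; 3; 5; 2; 2; 3; 4]);
  ([:: 1; 1; 3; 3; 2; 2], [:: 5; 5; 3; 4; 4; 5; 2; 1; 4]);
  ([:: 4; 4; 3; 3; 5], [:: 3; 2; 2; 4; 1; 1; 2; 5; 5; 1]);
  ([:: 2; 2; 4; 4], [:: 5; 5; 3; 3; 4; 1; 1; 5; 2; 1; 3]);
  ([:: 5; 5; 1], [:: 3; 3; 5; 4; 4; 3; 2; 2; 1; 1; 4; 2]);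
  ([:: 5; 3], [:: 2; 2; 3; 3; 1; 1; 4; 4; 5; 5; 1; 2; 4])].

(** An entry 0 is an inner visit to the color of the center. *)
Definition table7 : seq (seq nat * seq nat) := [::
  ([:: 6; 6; 3; 3; 0; 1; 1; 6; 2; 2; 1; 4], [:: 2; 5; 5; 1; 3; 5; 6; 4; 4; 3; 2; 4; 5]);
  ([:: 6; 6; 1; 1; 0; 5; 5; 1; 2; 2; 4], [:: 3; 3; 6; 2; 3; 4; 4; 1; 3; 5; 6; 4; 5; 2]);
  ([:: 3; 3; 1; 1; 0; 6; 6; 2; 2; 5], [:: 2; 3; 6; 1; 2; 4; 4; 3; 5; 4])].

Definition table8 : seq (seq nat * seq nat) := [::
  ([:: 3; 3; 1; 1; 4; 4; 2; 2; 1; 0; 6; 6; 4; 7],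
   [:: 5; 5; 7; 7; 2; 3; 4; 5; 1; 6; 7; 3; 5; 6; 2])].

Lemma table_covers_range (k : nat) (T : seq (seq nat * seq nat))
    (P : nat -> nat -> bool) (n c2 c3 : nat) :
  all (fun i => all (fun j => P i j ==> table_covers k T i j) (iota 0 n)) (iota 0 n) ->
  c2 < n -> c3 < n -> P c2 c3 -> trail_pair k c2 c3.
Proof.
move=> /allP T_all c2_lt c3_lt P23; apply: (table_covers_trail_pair _ T).
have /allP/(_ c3) := T_all c2 ltac:(by rewrite mem_iota).
by rewrite mem_iota => /(_ c3_lt) /implyP; apply.
Qed.

Lemma trail_pairs_exist5 : trail_pairs_exist 5.
Proof.
move=> c2 c3 /andP[? ?] /= ?.
by apply: (table_covers_range 5 table5 (fun i j => [&& 3 <= i, i <= j & i + j <= 14]) 13);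
  [vm_compute | lia..].
Qed.

Lemma trail_pairs_exist6 : trail_pairs_exist 6.
Proof.
move=> c2 c3 /andP[? ?] /= ?.
have [e_le|e_gt] := leqP (c2 + c3) 14.
  by apply: (trail_pair_widen 5) => //; apply: trail_pairs_exist5; rewrite /=; lia.
by apply: (table_covers_range 6 table6 (fun i j => [&& 3 <= i, i <= j & 14 < i + j <= 17]) 18);
  [vm_compute | lia..].
Qed.

Lemma trail_pairs_exist7 : trail_pairs_exist 7.
Proof.
move=> c2 c3 c23 e_le.
have [//|[d []] dE d_gt0 c3_lt] := trail_pairs_step 5 c2 c3 isT trail_pairs_exist5 c23 e_le.
(* Here c2 + c3 = 14 + d and c3 is at most d + 3 and at most 15, which with c2 <= c3 leaves only
   this range. *)
by apply: (table_covers_range 7 table7 (fun i j => [&& 11 <= i, i <= j, j <= 15 & i + j <= 27]) 18);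
  [vm_compute | lia..].
Qed.

Lemma trail_pairs_exist8 : trail_pairs_exist 8.
Proof.
move=> c2 c3 c23 e_le.
have [//|[d []] dE d_gt0 c3_lt] := trail_pairs_step 6 c2 c3 isT trail_pairs_exist6 c23 e_le.
(* Likewise c2 + c3 = 17 + d and c3 is at most d + 3 and at most 16. *)
by apply: (table_covers_range 8 table8 (fun i j => [&& 14 <= i, i <= j, j <= 16 & i + j <= 31]) 18);
  [vm_compute | lia..].
Qed.

Lemma trail_pairs_existP (k : nat) : 4 < k -> trail_pairs_exist k.
Proof.
have [n] := ubnP k; elim: n k => // n IH k k_le k_gt4.
have [k_gt8|k_le8] := ltnP 8 k; last first.
  have : k \in [:: 5; 6; 7; 8] by rewrite !inE; lia.
  rewrite !inE => /or4P[] /eqP->; [exact: trail_pairs_exist5|exact: trail_pairs_exist6|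
    exact: trail_pairs_exist7|exact: trail_pairs_exist8].
case: k k_le k_gt4 k_gt8 => [|[|k]] // k_le _ k_gt8 c2 c3 c23 e_le.
have exist_k : trail_pairs_exist k by apply: IH; lia.
rewrite /= negbK in e_le.
have [//|[d [dE d_gt0 c3_lt]]] := trail_pairs_step k c2 c3 ltac:(lia) exist_k c23 e_le.
(* Now [k] is at least 7: c3 is at least half of c2 + c3, which is quadratic in [k], and this
   contradicts the linear bound [c3_lt]. *)
by nia.
Qed.

(** * Exclusion of four colors *)

Fixpoint all_words (k n : nat) (P : pred (seq nat)) : bool :=
  if n is m.+1 then all (fun i => all_words k m (fun s => P (i :: s))) (iota 0 k)
  else P [::].

Lemma all_wordsP (k n : nat) (P : pred (seq nat)) (s : seq nat) :
  all_words k n P -> size s = n -> all (ltn^~ k) s -> P s.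
Proof.
elim: n P s => [|n IH] P [|i s] //= /allP all_P [sz] /andP[i_lt s_lt].
by apply: (IH (fun s => P (i :: s))) => //; apply: all_P; rewrite mem_iota.
Qed.

(** The lengths 3, 3 and 3, 4 are the only ones that the degree bound allows for four colors. *)
Lemma petal_trails4F (x : nat) (p q : seq nat) :
  size p = 2 -> 2 <= size q <= 3 -> ~~ petal_trails 4 x p q.
Proof.
move=> sp sq; apply/negP => pq; have [lt4 _] := andP pq.
pose bad s := ~~ petal_trails 4 (head 0 s) (take 2 (behead s)) (drop 2 (behead s)).
suff : bad (x :: p ++ q).
  by rewrite /bad [head _ _]/= [behead _]/= take_size_cat // drop_size_cat // pq.
have [sq2|sq3] : size q = 2 \/ size q = 3 by lia.
  by apply: (all_wordsP 4 5 bad) lt4; [vm_compute | rewrite /= size_cat sp sq2].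
by apply: (all_wordsP 4 6 bad) lt4; [vm_compute | rewrite /= size_cat sp sq3].
Qed.

(** * Bounds for the chromatic number *)

Lemma petal_chromatic_bound (c2 c3 : nat) :
  3 <= c2 <= c3 -> let l := edge_distinguishing_chromatic_number (petal_graph c2 c3) in
  4 < l /\ 2 * (1 + c2 + c3) <= l * (l + odd l).
Proof.
move=> /andP[c2_ge c23] l; have c3_ge := leq_trans c2_ge c23.
have : edc_admissible (petal_graph c2 c3) l.
  by rewrite /l /edge_distinguishing_chromatic_number; case: ex_minnP.
case/(edc_admissible_petalP _ _ c2_ge c3_ge) => x [p [q [sp sq pq]]].
have bound := petal_trails_bound _ _ _ _ pq.
split; last by lia.
have [//|l_le] := ltnP 4 l.
have [l4|[l3|[l2|[l1|l0]]]] : l = 4 \/ l = 3 \/ l = 2 \/ l = 1 \/ l = 0 by lia.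
- rewrite l4 in bound pq; case/negP: (petal_trails4F x p q ltac:(lia) ltac:(lia)).
  exact: pq.
(* With at most three colors the bound gives 2e <= 12, but e is at least 7. *)
all: by rewrite ?l3 ?l2 ?l1 ?l0 in bound; lia.
Qed.

Lemma petal_chromatic_le (k c2 c3 : nat) :
  4 < k -> 3 <= c2 <= c3 -> 2 * (1 + c2 + c3) <= k * (k + odd k) ->
  edge_distinguishing_chromatic_number (petal_graph c2 c3) <= k.
Proof.
move=> k_gt4 c23 e_le; rewrite /edge_distinguishing_chromatic_number.
case: ex_minnP => l _; apply; apply/edc_admissible_petalP; try lia.
by have [p [q ?]] := trail_pairs_existP k k_gt4 c2 c3 c23 e_le; exists 0, p, q.
Qed.

(** * Ceilings and the closed formula *)

(** The real number is the positive root of x^2 + x = 2e, and x^2 + x increases for positive x. *)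
Lemma ceil_triangular_root (R : realType) (e k : nat) :
  0 < k -> k * k.-1 < 2 * e <= k * k.+1 ->
  (Num.ceil ((- 1 + Num.sqrt (8 * e%:R + 1)) / 2 : R) = k :> int)%R.
Proof.
case: k => // k _ /=; rewrite -(ltr_nat R) -(ler_nat R) !natrM -[k.+2]addn2 -addn1 !natrD.
set x := (k%:R)%R; set y := (e%:R)%R => /andP[lo hi].
have x0 : (0 <= x :> R)%R by apply: ler0n.
have y0 : (0 <= y :> R)%R by apply: ler0n.
have sq : (Num.sqrt (8 * y + 1) ^+ 2 = 8 * y + 1 :> R)%R by rewrite sqr_sqrtr //; lra.
have := sqrtr_ge0 (8 * y + 1)%R; set s := Num.sqrt _ in sq * => s0.
have s_lo : (2 * x + 1 < s)%R by nra.
have s_hi : (s <= 2 * x + 3)%R by nra.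
apply: ceil_def; rewrite rmorphB /= -!pmulrn natrD -/x; lra.
Qed.

Lemma ceil_sqrt (R : realType) (n k : nat) :
  0 < k -> k.-1 * k.-1 < n <= k * k ->
  (Num.ceil (Num.sqrt n%:R : R) = k :> int)%R.
Proof.
case: k => // k _ /=; rewrite -(ltr_nat R) -(ler_nat R) !natrM -addn1 !natrD.
set x := (k%:R)%R; set y := (n%:R)%R => /andP[lo hi].
have x0 : (0 <= x :> R)%R by apply: ler0n.
have y0 : (0 <= y :> R)%R by apply: ler0n.
have sq : (Num.sqrt y ^+ 2 = y :> R)%R by rewrite sqr_sqrtr.
have := sqrtr_ge0 y; set s := Num.sqrt _ in sq * => s0.
have s_lo : (x < s)%R by nra.
have s_hi : (s <= x + 1)%R by nra.
apply: ceil_def; rewrite rmorphB /= -!pmulrn natrD -/x; lra.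
Qed.

Local Open Scope ring_scope.

Theorem theorem4p1 (R : realType) (c2 c3 : nat)
    (hc2 : (3 <= c2)%N) (hc23 : (c2 <= c3)%N) :
  let e := (1 + c2 + c3)%N in
  let m : int := Num.ceil ((- 1 + Num.sqrt (8 * e%:R + 1)) / 2 : R) in
  (edge_distinguishing_chromatic_number (petal_graph c2 c3))%:Z =
  if (e <= 10)%N then 5
  else if ~~ (2 %| m)%Z then m
  else Num.ceil (Num.sqrt (2 * e%:R) : R).
Proof.
move=> e m.
have c23 : (3 <= c2 <= c3)%N by rewrite hc2.
have [l_gt4 l_ge] := petal_chromatic_bound c2 c3 c23.
have l_le k : (4 < k)%N -> (2 * e <= k * (k + odd k))%N -> _ :=
  fun h => petal_chromatic_le k c2 c3 h c23.
rewrite -/e in l_ge; set l := edge_distinguishing_chromatic_number _ in l_gt4 l_ge l_le *.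
have [e_le|e_gt] := leqP e 10.
  by have := l_le 5 isT ltac:(rewrite /=; lia); lia.
(* [k] is the least number with 2e <= k(k + 1), which will be the ceiling [m]. *)
have [k [k_lo k_hi]] : exists k, (k * k.-1 < 2 * e)%N /\ (2 * e <= k * k.+1)%N.
  have ex : exists k, (2 * e <= k * k.+1)%N by exists (2 * e)%N; nia.
  exists (ex_minn ex); case: ex_minnP => k k_hi k_min; split=> //.
  rewrite ltnNge; apply/negP => k_lo; case: k k_hi k_min k_lo => [|k] k_hi k_min k_lo; first by lia.
  by have := k_min k; rewrite (mulnC k) => /(_ k_lo); rewrite ltnn.
have k_gt4 : (4 < k)%N by nia.
have lk : (k <= l)%N.
  (* Fewer than [k] colors carry at most k(k - 1) < 2e degrees in total. *)
  rewrite leqNgt; apply/negP => l_lt; have := leq_b1 (odd l); nia.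
have -> : m = k by apply: ceil_triangular_root; lia.
have -> : (2 %| k%:Z)%Z = ~~ odd k by rewrite dvdzE /= dvdn2.
rewrite negbK -natrM; have [k_odd|k_even] := boolP (odd k).
  by have := l_le k k_gt4; rewrite k_odd addn1 => /(_ k_hi); lia.
(* For even [k] the capacity is only k^2; beyond it the odd number k + 1 of colors suffices, and the
   square root of 2e lies between k and k + 1. *)
have [e_le|e_gt_sq] := leqP (2 * e) (k * k).
  rewrite (ceil_sqrt _ _ k) //; [|lia|apply/andP; split; nia].
  by have := l_le k k_gt4; rewrite (negPf k_even) addn0 => /(_ e_le); lia.
rewrite (ceil_sqrt _ _ k.+1) //; last by apply/andP; split => //; nia.
have l_gt : (k < l)%N.
  rewrite ltn_neqAle lk andbT; apply/eqP => kl.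
  by move: l_ge; rewrite -kl (negPf k_even); lia.
have := l_le k.+1 (leqW k_gt4); rewrite /= k_even => /(_ ltac:(nia)); lia.
Qed.
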